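(* Let $n\ge1$. The variety $\Delta^2(\mathbb{A}^n)$ is isomorphic over $(\mathbb{C}^2)^{\circ}$ to the image of the map $$(\mathbb{C}^2)^{\circ}\times\mathbb{A}^n\times\mathbb{A}^n\to(\mathbb{C}^2)^{\circ}\times\mathbb{C}^n\times\mathrm{Sym}^2\mathbb{C}^n\times\mathrm{Sym}^3\mathbb{C}^n$$ taking $$(m_1,m_2,v_1,v_2)\mapsto(m_1,m_2,v_1,v_2^2,(m_1-m_2)v_2^3).$$ In particular, the family $\Delta^2(\mathbb{A}^n)\to(\mathbb{C}^2)^\circ$ is isotrivial.
   Context: $(\mathbb{C}^2)^\circ=\{(m_1,m_2)\in\mathbb{C}^2: m_1\ne0,\ m_2\neq0,\ m_1+m_2\ne0\}$. $\mathrm{Sym}^i\mathbb{C}^n$ denotes the $i$-th symmetric power as a vector space, and for $v\in\mathbb{C}^n$, $v^i\in\mathrm{Sym}^i\mathbb{C}^n$ is the symmetric power of $v$. Let $e_i(y_1,y_2,x_1,x_2)=\sum_{a+b=i}\binom{y_1}{a}\binom{y_2}{b}x_1^ax_2^b$, with $\binom ya=y(y-1)\cdots(y-a+1)/a!$; for vectors $v_1,v_2\in\mathbb{C}^n$ in place of $x_1,x_2$, products are taken in $\mathrm{Sym}^i\mathbb{C}^n$. For $N$ sufficiently large the morphism $$(\mathbb{C}^2)^\circ\times(\mathbb{A}^n)^2\to(\mathbb{C}^2)^\circ\times\prod_{i=1}^N\mathrm{Sym}^i\mathbb{C}^n,\quad(m_1,m_2,v_1,v_2)\mapsto\big(m_1,m_2,(e_i(m_1,m_2,v_1,v_2))_{1\le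 i\le N}\big)$$ is finite, and its image (a closed subvariety, with reduced structure) is independent of $N$ up to the coordinate projections, which are isomorphisms. This image is $\Delta^2(\mathbb{A}^n)$, a variety over $(\mathbb{C}^2)^\circ$. A family is called isotrivial if its (reduced) fibers over the points of some nonempty Zariski-open subset of the base are all isomorphic to each other. *)

(* Defs.v *)
From HB Require Import structures.
From mathcomp Require Import all_boot all_order all_algebra.
From mathcomp Require Import classical_sets reals complex mpoly.

Set Implicit Arguments.
Unset Strict Implicit.
Unset Printing Implicit Defensive.

Import GRing.Theory.
Local Open Scope ring_scope.
Local Open Scope classical_set_scope.

(* MathComp provides no module structure on dependent finite products. *)
Section DependentProduct.
Variables (K : fieldType) (I : finType) (V : I -> lmodType K).

Definition dprodmod : Type := {dffun forall i, V i}.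

HB.instance Definition _ := Choice.on dprodmod.

Implicit Types f g h : dprodmod.

Definition dprod_zero : dprodmod := [ffun i => 0 : V i].
Definition dprod_opp f : dprodmod := [ffun i => - f i].
Definition dprod_add f g : dprodmod := [ffun i => f i + g i].
Definition dprod_scale (a : K) f : dprodmod := [ffun i => a *: f i].

Fact dprod_addA : associative dprod_add.
Proof. by move=> f g h; apply/ffunP=> i; rewrite !ffunE addrA. Qed.
Fact dprod_addC : commutative dprod_add.
Proof. by move=> f g; apply/ffunP=> i; rewrite !ffunE addrC. Qed.
Fact dprod_add0 : left_id dprod_zero dprod_add.
Proof. by move=> f; apply/ffunP=> i; rewrite !ffunE add0r. Qed.
Fact dprod_addN : left_inverse dprod_zero dprod_opp dprod_add.
Proof. by move=> f; apply/ffunP=> i; rewrite !ffunE addNr. Qed.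

HB.instance Definition _ :=
  GRing.isZmodule.Build dprodmod dprod_addA dprod_addC dprod_add0 dprod_addN.

Fact dprod_scaleA a b f :
  dprod_scale a (dprod_scale b f) = dprod_scale (a * b) f.
Proof. by apply/ffunP=> i; rewrite !ffunE scalerA. Qed.
Fact dprod_scale1 : left_id 1 dprod_scale.
Proof. by move=> f; apply/ffunP=> i; rewrite !ffunE scale1r. Qed.
Fact dprod_scaleDr : right_distributive dprod_scale +%R.
Proof. by move=> a f g; apply/ffunP=> i; rewrite !ffunE scalerDr. Qed.
Fact dprod_scaleDl f : {morph dprod_scale^~ f : a b / a + b}.
Proof. by move=> a b; apply/ffunP=> i; rewrite !ffunE scalerDl. Qed.

HB.instance Definition _ := GRing.Zmodule_isLmodule.Build K dprodmod
  dprod_scaleA dprod_scale1 dprod_scaleDr dprod_scaleDl.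

End DependentProduct.

(* Varieties are locally closed subsets (with their reduced structure) of      *)
(* finite-dimensional K-vector spaces V, seen as affine spaces.  [polyfun] is   *)
(* the coordinate ring of V: the algebra of functions generated by its dual.    *)
Section Varieties.
Variable K : fieldType.

Inductive polyfun (V : lmodType K) : (V -> K) -> Prop :=
| polyfun_lin (l : V -> K) : scalar l -> polyfun l
| polyfun_cst (c : K) : polyfun (fun=> c)
| polyfun_add (f g : V -> K) :
    polyfun f -> polyfun g -> polyfun (fun x => f x + g x)
| polyfun_mul (f g : V -> K) :
    polyfun f -> polyfun g -> polyfun (fun x => f x * g x).

Definition zariski_closed (V : lmodType K) (Z : set V) : Prop :=
  exists S : set (V -> K),
    (forall f, S f -> polyfun f) /\ Z = [set x | forall f, S f -> f x = 0].

Definition zariski_open (V : lmodType K) (U : set V) : Prop :=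
  zariski_closed (~` U).

Definition locally_closed (V : lmodType K) (X : set V) : Prop :=
  exists U Z : set V, [/\ zariski_open U, zariski_closed Z & X = U `&` Z].

Definition regular_function (V : lmodType K) (X : set V) (f : V -> K) : Prop :=
  forall x, X x -> exists (U : set V) (g h : V -> K),
    [/\ zariski_open U, U x, polyfun g, polyfun h &
        forall y, X y -> U y -> h y != 0 /\ f y = g y / h y].

Definition regular_map (V W : lmodType K) (X : set V) (Y : set W)
    (phi : V -> W) : Prop :=
  (forall x, X x -> Y (phi x)) /\
  (forall l : W -> K, scalar l -> regular_function X (l \o phi)).

Definition biregular (V W : lmodType K) (X : set V) (Y : set W)
    (phi : V -> W) (psi : W -> V) : Prop :=
  [/\ regular_map X Y phi, regular_map Y X psi,
      forall x, X x -> psi (phi x) = x & forall y, Y y -> phi (psi y) = y].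

Definition isomorphic (V W : lmodType K) (X : set V) (Y : set W) : Prop :=
  [/\ locally_closed X, locally_closed Y &
      exists (phi : V -> W) (psi : W -> V), biregular X Y phi psi].

Definition isomorphic_over (B V W : lmodType K) (p : V -> B) (q : W -> B)
    (X : set V) (Y : set W) : Prop :=
  [/\ locally_closed X, locally_closed Y &
      exists (phi : V -> W) (psi : W -> V),
        biregular X Y phi psi /\ forall x, X x -> q (phi x) = p x].

Definition fiber (B V : lmodType K) (p : V -> B) (X : set V) (b : B) : set V :=
  [set x | X x /\ p x = b].

Definition isotrivial (B V : lmodType K) (S : set B) (p : V -> B)
    (X : set V) : Prop :=
  exists U : set B, [/\ zariski_open U, (S `&` U) !=set0 &
    forall s t, (S `&` U) s -> (S `&` U) t ->
      isomorphic (fiber p X s) (fiber p X t)].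

End Varieties.

Definition gbinom (K : fieldType) (y : K) (a : nat) : K :=
  (\prod_(j < a) (y - j%:R)) / a`!%:R.

Definition epoly (K : fieldType) (A : algType K) (i : nat) (y1 y2 : K)
    (x1 x2 : A) : A :=
  \sum_(a < i.+1) \sum_(b < i.+1 | (a + b == i)%N)
    (gbinom y1 a * gbinom y2 b) *: (x1 ^+ a * x2 ^+ b).

(* The symmetric algebra of K^n is the polynomial ring in n variables, a vector *)
(* being identified with its linear form, so that Sym^i K^n is the space of     *)
(* homogeneous polynomials of degree i.                                        *)
Section Sym.
Variables (K : fieldType) (n : nat).

Definition Sym (i : nat) : lmodType K := dhomog n K i.

Definition symvec (v : 'rV[K]_n) : {mpoly K[n]} := \sum_(j < n) v 0 j *: 'X_j.

Lemma symvecX_homog (v : 'rV[K]_n) i : symvec v ^+ i \is i.-homog.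
Proof.
rewrite -{2}(mul1n i); apply: dhomogMn; apply: rpred_sum => j _.
by apply: dhomogZ; rewrite dhomogX /= mdeg1.
Qed.

Definition sympow (i : nat) (v : 'rV[K]_n) : Sym i :=
  DHomog (symvecX_homog v i).

Lemma epoly_homog i (y1 y2 : K) (v1 v2 : 'rV[K]_n) :
  epoly i y1 y2 (symvec v1) (symvec v2) \is i.-homog.
Proof.
rewrite /epoly; apply: rpred_sum => a _; apply: rpred_sum => b /eqP ab.
by apply: dhomogZ; rewrite -{3}ab; apply: dhomogM; apply: symvecX_homog.
Qed.

Definition symepoly (i : nat) (y1 y2 : K) (v1 v2 : 'rV[K]_n) : Sym i :=
  DHomog (epoly_homog i y1 y2 v1 v2).

End Sym.

Section Delta.
Variables (K : fieldType) (n : nat).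

Definition base : set (K^o * K^o)%type :=
  [set m | [/\ m.1 != 0, m.2 != 0 & m.1 + m.2 != 0]].

(* The index i : 'I_N stands for the factor Sym^(i+1). *)
Definition Delta_space (N : nat) : lmodType K :=
  ((K^o * K^o) * dprodmod (fun i : 'I_N => Sym K n i.+1))%type.

Definition Delta_map (N : nat)
    (x : (K^o * K^o) * ('rV[K]_n * 'rV[K]_n)) : Delta_space N :=
  let: ((m1, m2), (v1, v2)) := x in
  ((m1, m2), [ffun i : 'I_N => @symepoly K n i.+1 m1 m2 v1 v2]).

(* For N sufficiently large this is the variety Delta^2(A^n). *)
Definition Delta2 (N : nat) : set (Delta_space N) :=
  @Delta_map N @` [set x | base x.1].

Definition cuspidal_space : lmodType K :=
  ((K^o * K^o) * ('rV[K]_n * Sym K n 2 * Sym K n 3))%type.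

Definition cuspidal_map
    (x : (K^o * K^o) * ('rV[K]_n * 'rV[K]_n)) : cuspidal_space :=
  let: ((m1, m2), (v1, v2)) := x in
  ((m1, m2), (v1, sympow 2 v2, (m1 - m2 : K) *: sympow 3 v2)).

Definition cuspidal : set cuspidal_space :=
  cuspidal_map @` [set x | base x.1].

End Delta.

Arguments base : clear implicits.
Arguments Delta2 : clear implicits.
Arguments cuspidal : clear implicits.

(* Main.v *)
(******************************************************************************)

(* In the coordinates [of_center], [newton_epoly] passes between the e_i and the power sums,
   dividing only by positive integers. [power_sum_centered] and [centered_coef_odd] show that each
   p_k involves u only through u^2 and (m1 - m2) u^3, so [descends_epoly] writes each e_k in these
   two and w, which gives [cuspidal_to_Delta]. In the other direction, p_1, p_2, p_3 form a
   triangular system in w, u^2, (m1 - m2) u^3 whose diagonal coefficients are units on the base,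
   which gives [Delta_to_cuspidal] and the bound 3 on N.

   Both maps are defined on the whole ambient spaces over the base, with coordinates of the form
   polynomial / (m1 m2 (m1 + m2))^k, so their regularity is formal. Being locally closed is proved
   for the explicit image in [cuspidal_laurent_closed] and then transported by
   [laurent_closed_retract]. Isotriviality follows by conjugating [rescale] with the isomorphism. *)
(* The e_i are the coefficients of (1 + v1 t)^m1 (1 + v2 t)^m2, so by Newton's *)
(* identities they determine, and are polynomials in, the weighted power sums  *)
(* p_k = m1 v1^k + m2 v2^k.  Let w be the barycenter (m1 v1 + m2 v2)/(m1 + m2) *)
(* and u = v1 - v2.  Then p_k = \sum_j C(k, j) c_j w^(k-j) u^j, where          *)
(*   c_j = (m1 m2^j + m2 (- m1)^j) / (m1 + m2)^j,                              *)
(* so c_1 = 0 and m1 - m2 divides c_j for odd j.  Hence every p_k is a         *)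
(* polynomial in w, u^2 and (m1 - m2) u^3 with coefficients regular on the     *)
(* base, and these three are conversely recovered from p_1, p_2 and p_3.       *)
(* The resulting maps are defined over the whole base and are inverse to each  *)
(* other on the two images.  The image of (w, u) |-> (w, u^2, (m1 - m2) u^3)   *)
(* is closed over the base: (w, a, b) lies in it iff a is the square of a      *)
(* linear form and b^2 = (m1 - m2)^2 a^3, since then b is (m1 - m2) (+/- u)^3. *)
(* Where m1 != m2, rescaling b identifies the fibers.                          *)
(******************************************************************************)
Require Import Defs.
From mathcomp Require Import all_boot all_order all_algebra.
From mathcomp Require Import classical_sets reals complex mpoly.
From mathcomp Require Import ring.

Set Implicit Arguments.
Unset Strict Implicit.
Unset Printing Implicit Defensive.

Import Order.TTheory GRing.Theory Num.Theory.
Local Open Scope ring_scope.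
Local Open Scope classical_set_scope.

(** * Newton identities *)

Section PowerSums.
Variables (K : numFieldType) (A : comAlgType K).
Implicit Types (y : K) (x w u : A).

Definition power_sum (y1 y2 : K) (x1 x2 : A) (k : nat) : A :=
  y1 *: x1 ^+ k + y2 *: x2 ^+ k.

Lemma gbinomS y a : gbinom y a.+1 *+ a.+1 = (y - a%:R) * gbinom y a.
Proof.
rewrite /gbinom big_ord_recr /= factS natrM -mulr_natr.
have ha : a.+1%:R != 0 :> K by rewrite pnatr_eq0.
have hf : a`!%:R != 0 :> K by rewrite pnatr_eq0 -lt0n fact_gt0.
by field; rewrite hf addrC natr1 ha.
Qed.

Lemma gbinom0 y : gbinom y 0 = 1.
Proof. by rewrite /gbinom big_ord0 fact0 divr1. Qed.

(** This is the coefficient of t^a in F' = F * (y x / (1 + x t)) for F = (1 + x t)^y. The induction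
    amounts to (1 + x t) F' = y x F. *)
Lemma binomial_newton y x a :
  (gbinom y a.+1 *: x ^+ a.+1) *+ a.+1 =
  \sum_(k < a.+1)
    (gbinom y k *: x ^+ k) * ((-1) ^+ (a - k) *: (y *: x ^+ (a - k).+1)).
Proof.
(* Turning scaling into multiplication by an opaque element of [A] lets [ring] close the goals. *)
have [f fE] : exists f : K -> A, forall c z, c *: z = f c * z.
  by exists (fun c => c%:A) => c z; rewrite mulr_algl.
elim: a => [|a IH].
  rewrite big_ord1 subn0 !expr0 scale1r scalerMnl gbinomS subr0 gbinom0 mulr1.
  by rewrite scale1r mul1r.
rewrite big_ord_recr /= subnn expr0 scale1r [LHS]scalerMnl gbinomS.
(* Raising a by one multiplies each old summand by -x; only the last summand is new. *)
rewrite (eq_bigr (fun k : 'I_a.+1 => - x * ((gbinom y k *: x ^+ k) *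
    ((-1) ^+ (a - k) *: (y *: x ^+ (a - k).+1))))).
  rewrite -mulr_sumr -IH scalerMnl.
  move: (gbinom y a.+1) => g.
  rewrite expr1 mulrBl scalerBl -[g *+ _]mulr_natl -!scalerA !fE !exprS.
  by ring.
move=> k _; have /subSn -> : (k <= a)%N by rewrite -ltnS.
rewrite exprS mulN1r scaleNr [x ^+ (a - k).+2]exprS !fE.
by ring.
Qed.

Lemma epolyE i y1 y2 x1 x2 :
  epoly i y1 y2 x1 x2 = \sum_(a < i.+1)
     (gbinom y1 a *: x1 ^+ a) * (gbinom y2 (i - a) *: x2 ^+ (i - a)).
Proof.
apply: eq_bigr => a _.
have ai : (a <= i)%N by rewrite -ltnS.
have hi : (i - a < i.+1)%N by rewrite ltnS leq_subr.
rewrite (big_pred1 (Ordinal hi)) => [|b].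
  by rewrite /= -scalerAl -scalerAr scalerA.
rewrite [RHS]/= -val_eqE /=; apply/eqP/eqP => [ab|->]; last by rewrite subnKC.
by have := addKn a b; rewrite ab.
Qed.

(* Logarithmic derivative of [(1 + x1 t)^y1 (1 + x2 t)^y2], truncated in [t]. *)
Lemma newton_epoly i y1 y2 x1 x2 :
  epoly i.+1 y1 y2 x1 x2 *+ i.+1 =
  \sum_(k < i.+1) epoly k y1 y2 x1 x2 *
     ((-1) ^+ (i - k) *: power_sum y1 y2 x1 x2 (i - k).+1).
Proof.
(* Terms up to degree i+1 are kept because the coefficient of t^i in a derivative involves degree
   i+1. *)
pose F y x : {poly A} := \poly_(a < i.+2) (gbinom y a *: x ^+ a).
pose P y x : {poly A} := \poly_(a < i.+2) ((-1) ^+ a *: (y *: x ^+ a.+1)).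
have FP y x k : (k <= i)%N -> (F y x)^`()`_k = (F y x * P y x)`_k.
  move=> ki; rewrite coef_deriv coef_poly !ltnS ki binomial_newton coefM.
  apply: eq_bigr => j _; rewrite !coef_poly.
  have ji : (j < i.+2)%N by rewrite (leq_trans (ltn_ord j)) // ltnS leqW.
  by rewrite ji ltnS (leq_trans (leq_subr _ _)) // leqW.
have eF k : (k <= i.+1)%N ->
    epoly k y1 y2 x1 x2 = (F y1 x1 * F y2 x2)`_k.
  move=> ki; rewrite epolyE coefM; apply: eq_bigr => j _; rewrite !coef_poly.
  by rewrite (leq_trans (ltn_ord j)) // ltnS (leq_trans (leq_subr _ _)).
have -> : epoly i.+1 y1 y2 x1 x2 *+ i.+1 = (F y1 x1 * F y2 x2)^`()`_i.
  by rewrite coef_deriv -eF.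
transitivity ((F y1 x1 * F y2 x2) * (P y1 x1 + P y2 x2))`_i; last first.
  rewrite coefM; apply: eq_bigr => k _; have ki : (k <= i)%N by rewrite -ltnS.
  rewrite -eF ?leqW // coefD !coef_poly ltnS (leq_trans (leq_subr _ _)) ?leqW //.
  by rewrite scalerDr.
rewrite derivM coefD mulrDr coefD; congr (_ + _).
  rewrite mulrAC !coefM; apply: eq_bigr => k _.
  by rewrite -FP // -ltnS.
rewrite -mulrA !coefM; apply: eq_bigr => k _.
by rewrite -FP // leq_subr.
Qed.

Definition centered_coef (m1 m2 : K) (j : nat) : K :=
  (m1 * m2 ^+ j + m2 * (- m1) ^+ j) / (m1 + m2) ^+ j.

(** Expanding both binomials, the coefficient of w^(k-j) u^j is C(k, j) times m1 (m2/m)^j + m2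
    (-m1/m)^j with m = m1 + m2, which is c_j. *)
Lemma power_sum_centered m1 m2 w u k :
  power_sum m1 m2 (w + (m2 / (m1 + m2)) *: u) (w - (m1 / (m1 + m2)) *: u) k =
  \sum_(j < k.+1) (centered_coef m1 m2 j *: (w ^+ (k - j) * u ^+ j)) *+ 'C(k, j).
Proof.
rewrite /power_sum !exprDn !scaler_sumr -big_split /=; apply: eq_bigr => j _.
rewrite -!scalerMnr -mulrnDl; congr (_ *+ _).
rewrite -scaleNr !exprZn -!scalerAr !scalerA -scalerDl; congr (_ *: _).
by rewrite /centered_coef -mulNr !exprMn mulrDl !mulrA exprVn.
Qed.

Lemma epoly0 y1 y2 x1 x2 : epoly 0 y1 y2 x1 x2 = 1.
Proof. by rewrite epolyE big_ord1 !gbinom0 !expr0 !scale1r mulr1. Qed.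

Lemma power_sum1E y1 y2 x1 x2 : power_sum y1 y2 x1 x2 1 = epoly 1 y1 y2 x1 x2.
Proof.
have := newton_epoly 0 y1 y2 x1 x2.
by rewrite big_ord1 epoly0 subnn expr0 scale1r mul1r mulr1n.
Qed.

Lemma power_sum2E y1 y2 x1 x2 : power_sum y1 y2 x1 x2 2 =
  epoly 1 y1 y2 x1 x2 * power_sum y1 y2 x1 x2 1 - epoly 2 y1 y2 x1 x2 *+ 2.
Proof.
rewrite newton_epoly big_ord_recr big_ord1 /= epoly0 mul1r subn0 subnn.
by rewrite expr0 expr1 scale1r scaleN1r; ring.
Qed.

Lemma power_sum3E y1 y2 x1 x2 : power_sum y1 y2 x1 x2 3 =
  epoly 3 y1 y2 x1 x2 *+ 3 - epoly 2 y1 y2 x1 x2 * power_sum y1 y2 x1 x2 1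
  + epoly 1 y1 y2 x1 x2 * power_sum y1 y2 x1 x2 2.
Proof.
rewrite newton_epoly !big_ord_recr big_ord0 /= epoly0 mul1r subn0 subnn subSnn.
by rewrite expr0 expr1 expr2 mulN1r opprK !scale1r scaleN1r; ring.
Qed.

Section Centered.
Variables (m1 m2 : K) (w u : A).
Hypothesis m_neq0 : m1 + m2 != 0.
Let m := m1 + m2.
Let x1 := w + (m2 / m) *: u.
Let x2 := w - (m1 / m) *: u.

Lemma centered_coef0 : centered_coef m1 m2 0 = m.
Proof. by rewrite /centered_coef !expr0 !mulr1 divr1. Qed.

Lemma centered_coef1 : centered_coef m1 m2 1 = 0.
Proof. by rewrite /centered_coef !expr1 mulrN [m2 * m1]mulrC subrr mul0r. Qed.

Lemma centered_coef2 : centered_coef m1 m2 2 = m1 * m2 / m.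
Proof. by rewrite /centered_coef /m; field. Qed.

Lemma centered_coef3 :
  centered_coef m1 m2 3 = - (m1 * m2 / m ^+ 2) * (m1 - m2).
Proof. by rewrite /centered_coef /m; field. Qed.

Lemma power_sum1_centered : power_sum m1 m2 x1 x2 1 = m *: w.
Proof.
rewrite power_sum_centered !big_ord_recr big_ord0 /=.
rewrite centered_coef0 centered_coef1 add0r subn0 subnn.
by rewrite expr0 expr1 mulr1 scale0r mul0rn addr0 bin0 mulr1n.
Qed.

Lemma power_sum2_centered :
  power_sum m1 m2 x1 x2 2 = m *: w ^+ 2 + (m1 * m2 / m) *: u ^+ 2.
Proof.
rewrite power_sum_centered !big_ord_recr big_ord0 /=.
rewrite centered_coef0 centered_coef1 centered_coef2 add0r subn0 subnn.
by rewrite !expr0 mulr1 mul1r scale0r mul0rn addr0 bin0 binn !mulr1n.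
Qed.

Lemma power_sum3_centered : power_sum m1 m2 x1 x2 3 =
  m *: w ^+ 3 + (m1 * m2 / m) *: (w * u ^+ 2) *+ 3
  - (m1 * m2 / m ^+ 2) *: ((m1 - m2) *: u ^+ 3).
Proof.
rewrite power_sum_centered !big_ord_recr big_ord0 /=.
rewrite centered_coef0 centered_coef1 centered_coef2 centered_coef3.
rewrite add0r subn0 subnn subSnn !expr0 expr1 mulr1 mul1r scale0r mul0rn addr0.
by rewrite bin0 binn !mulr1n scalerA mulNr scaleNr.
Qed.

End Centered.

End PowerSums.
(** * Functions with poles off the base *)

Section LaurentFunctions.
Variable K : fieldType.
Implicit Types (V W : lmodType K).

Local Notation bundle V := ((K^o * K^o) * V)%type.

Definition disc (m : K * K) : K := m.1 * m.2 * (m.1 + m.2).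

Lemma baseE m : base K m <-> disc m != 0.
Proof.
rewrite /disc !mulf_eq0 !negb_or -andbA.
by split=> [[-> -> ->]|/and3P[? ? ?]].
Qed.

(* Nothing is required off the base, where the division returns junk. *)
Definition laurent V (f : bundle V -> K) : Prop :=
  exists (g : bundle V -> K) (k : nat), polyfun g /\
    forall x, base K x.1 -> f x = g x / disc x.1 ^+ k.

Section Closure.
Variable V : lmodType K.
Implicit Types (f g : bundle V -> K).

Lemma eq_laurent f g :
  (forall x, base K x.1 -> f x = g x) -> laurent g -> laurent f.
Proof.
by move=> fg [h [k [ph hE]]]; exists h, k; split=> // x bx; rewrite fg ?hE.
Qed.

Lemma laurent_polyfun f : polyfun f -> laurent f.
Proof. by move=> pf; exists f, 0%N; split=> // x _; rewrite expr0 divr1. Qed.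

Lemma laurent_scalar f : scalar f -> laurent f.
Proof. by move=> lf; apply/laurent_polyfun/polyfun_lin. Qed.

Lemma laurent_cst c : laurent (fun _ : bundle V => c).
Proof. exact/laurent_polyfun/polyfun_cst. Qed.

Lemma polyfun_disc : polyfun (fun x : bundle V => disc x.1).
Proof.
by apply: polyfun_mul; [apply: polyfun_mul | apply: polyfun_add];
  apply: polyfun_lin.
Qed.

Lemma polyfun_exp f k : polyfun f -> polyfun (fun x => f x ^+ k).
Proof.
move=> pf; elim: k => [|k IH]; first exact: polyfun_cst 1.
rewrite (_ : (fun x => _) = (fun x => f x * f x ^+ k)); first exact: polyfun_mul.
by apply: boolp.funext => x; rewrite exprS.
Qed.

Lemma laurentD f g : laurent f -> laurent g -> laurent (fun x => f x + g x).
Proof.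
move=> [p [k [pp fE]]] [q [l [pq gE]]].
exists (fun x => p x * disc x.1 ^+ l + q x * disc x.1 ^+ k), (k + l)%N; split.
  by apply: polyfun_add; apply: polyfun_mul => //; apply/polyfun_exp/polyfun_disc.
move=> x bx; rewrite fE // gE //; move/baseE: bx => dx.
by rewrite exprD; field; rewrite !expf_neq0.
Qed.

Lemma laurentM f g : laurent f -> laurent g -> laurent (fun x => f x * g x).
Proof.
move=> [p [k [pp fE]]] [q [l [pq gE]]].
exists (fun x => p x * q x), (k + l)%N; split; first exact: polyfun_mul.
by move=> x bx; rewrite fE // gE // exprD invfM mulrACA.
Qed.

Lemma laurentN f : laurent f -> laurent (fun x => - f x).
Proof.
move=> lf; apply: (@eq_laurent _ (fun x => (-1) * f x)).
  by move=> x _; rewrite mulN1r.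
by apply: laurentM => //; apply: laurent_cst.
Qed.

Lemma laurentB f g : laurent f -> laurent g -> laurent (fun x => f x - g x).
Proof. by move=> lf lg; apply: laurentD => //; apply: laurentN. Qed.

Lemma laurentX f k : laurent f -> laurent (fun x => f x ^+ k).
Proof.
move=> lf; elim: k => [|k IH]; first exact: laurent_cst 1.
apply: (@eq_laurent _ (fun x => f x * f x ^+ k)); last exact: laurentM.
by move=> x _; rewrite exprS.
Qed.

Lemma laurent_sum (I : Type) (r : seq I) (P : pred I) (f : I -> bundle V -> K) :
  (forall i, P i -> laurent (f i)) ->
  laurent (fun x => \sum_(i <- r | P i) f i x).
Proof.
move=> lf; elim: r => [|i r IH].
  by apply: (@eq_laurent _ (fun=> 0)) (laurent_cst 0) => x _; rewrite big_nil.
apply: (@eq_laurent _ (fun x => (if P i then f i x else 0) +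
                                \sum_(i <- r | P i) f i x)).
  by move=> x _; rewrite big_cons; case: ifP => _; rewrite ?add0r.
by apply: laurentD => //; case Pi: (P i); [exact: lf | exact: laurent_cst].
Qed.

Lemma laurent_m1 : laurent (fun x : bundle V => x.1.1).
Proof. exact: laurent_scalar. Qed.

Lemma laurent_m2 : laurent (fun x : bundle V => x.1.2).
Proof. exact: laurent_scalar. Qed.

Lemma laurent_discV : laurent (fun x : bundle V => (disc x.1)^-1).
Proof.
exists (fun=> 1), 1%N; split; first exact: polyfun_cst.
by move=> x _; rewrite expr1 div1r.
Qed.

Lemma laurent_m1V : laurent (fun x : bundle V => x.1.1^-1).
Proof.
apply: (@eq_laurent _ (fun x => x.1.2 * (x.1.1 + x.1.2) * (disc x.1)^-1)).
  by move=> x [h1 h2 h3]; rewrite /disc; field; apply/and3P.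
by do !apply: laurentM; try apply: laurentD; try exact: laurent_scalar;
  exact: laurent_discV.
Qed.

Lemma laurent_m2V : laurent (fun x : bundle V => x.1.2^-1).
Proof.
apply: (@eq_laurent _ (fun x => x.1.1 * (x.1.1 + x.1.2) * (disc x.1)^-1)).
  by move=> x [h1 h2 h3]; rewrite /disc; field; apply/and3P.
by do !apply: laurentM; try apply: laurentD; try exact: laurent_scalar;
  exact: laurent_discV.
Qed.

Lemma laurent_m12V : laurent (fun x : bundle V => (x.1.1 + x.1.2)^-1).
Proof.
apply: (@eq_laurent _ (fun x => x.1.1 * x.1.2 * (disc x.1)^-1)).
  by move=> x [h1 h2 h3]; rewrite /disc; field; apply/and3P.
by do !apply: laurentM; try exact: laurent_scalar; exact: laurent_discV.
Qed.

End Closure.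

Definition laurent_map V W (F : bundle V -> W) : Prop :=
  forall l : W -> K, scalar l -> laurent (l \o F).

(** [F] may move the base point, as [rescale] does, so the inverse of the pulled-back [disc] has to
    be Laurent by assumption. The numerator is handled by induction on how it is generated from
    linear forms. *)
Lemma laurent_comp V V' (F : bundle V -> bundle V') (f : bundle V' -> K) :
  (forall x, base K x.1 -> base K (F x).1) ->
  laurent (fun x => (disc (F x).1)^-1) ->
  laurent_map F -> laurent f -> laurent (f \o F).
Proof.
move=> bF dF lF [g [k [pg fE]]].
apply: (@eq_laurent _ _ (fun x => g (F x) * (disc (F x).1)^-1 ^+ k)).
  by move=> x bx; rewrite exprVn -fE //; apply: bF.
apply: laurentM; last exact: laurentX.
elim: pg => [l /lF //|c|g1 g2 _ IH1 _ IH2|g1 g2 _ IH1 _ IH2].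
- exact: laurent_cst.
- exact: laurentD.
- exact: laurentM.
Qed.

Lemma scalar0 W (l : W -> K) : scalar l -> l 0 = 0.
Proof.
move=> hl; have := hl (-1) 0 0.
by rewrite scaler0 addr0 mulN1r addNr.
Qed.

Lemma scalarD W (l : W -> K) x y : scalar l -> l (x + y) = l x + l y.
Proof. by move=> hl; have := hl 1 x y; rewrite scale1r mul1r. Qed.

Lemma scalarZ W (l : W -> K) a x : scalar l -> l (a *: x) = a * l x.
Proof. by move=> hl; have := hl a x 0; rewrite scalar0 // !addr0. Qed.

Lemma scalar_sum W (l : W -> K) (I : Type) (r : seq I) (P : pred I) (x : I -> W) :
  scalar l -> l (\sum_(i <- r | P i) x i) = \sum_(i <- r | P i) l (x i).
Proof.
move=> hl; apply: (big_morph l) => [y z|]; [exact: scalarD | exact: scalar0].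
Qed.

Lemma laurent_map_pair V W1 W2 (F : bundle V -> W1) (G : bundle V -> W2) :
  laurent_map F -> laurent_map G -> laurent_map (fun x => (F x, G x)).
Proof.
move=> lF lG l hl.
apply: (@eq_laurent _ _ (fun x => l (F x, 0) + l (0, G x))).
  move=> x _ /=; rewrite -scalarD //; congr l.
  by congr (_, _) => /=; rewrite ?addr0 ?add0r.
apply: laurentD;
  [apply: (lF (fun a => l (a, 0))) | apply: (lG (fun a => l (0, a)))].
  move=> a u v; rewrite -hl; congr l.
  by congr (_, _) => /=; rewrite scaler0 add0r.
move=> a u v; rewrite -hl; congr l.
by congr (_, _) => /=; rewrite scaler0 add0r.
Qed.

Lemma laurent_map_row V n (F : bundle V -> 'rV[K]_n) :
  (forall j, laurent (fun x => F x 0 j)) -> laurent_map F.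
Proof.
move=> lF l hl.
apply: (@eq_laurent _ _ (fun x => \sum_j F x 0 j * l (delta_mx 0 j))).
  move=> x _ /=; rewrite [F x in LHS]row_sum_delta scalar_sum //.
  by apply: eq_bigr => j _; rewrite scalarZ.
by apply: laurent_sum => j _; apply: laurentM => //; apply: laurent_cst.
Qed.

Lemma laurent_map_dprod V (I : finType) (W : I -> lmodType K)
    (F : bundle V -> dprodmod W) :
  (forall i, laurent_map (fun x => F x i)) -> laurent_map F.
Proof.
move=> lF l hl.
(* A linear form on the product is the sum of its restrictions along the inclusions of the
   factors. *)
pose single i (v : W i) : dprodmod W := [ffun j => dfwith (fun j => 0 : W j) v j].
have singleE i a (u v : W i) :
    single i (a *: u + v) = a *: single i u + single i v.
  apply/ffunP => j; rewrite !ffunE; case: (eqVneq i j) => [<-|ij].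
    by rewrite !dfwith_in.
  by rewrite !dfwith_out // scaler0 addr0.
apply: (@eq_laurent _ _ (fun x => \sum_i l (single i (F x i)))).
  move=> x _; rewrite -scalar_sum //=; congr l; apply/ffunP => j.
  have sumE (s : seq I) (G : I -> dprodmod W) :
      (\sum_(i <- s) G i) j = \sum_(i <- s) G i j.
    by apply: (big_morph (fun f : dprodmod W => f j)) => [f g|]; rewrite ffunE.
  rewrite sumE (bigD1 j) //= big1 ?addr0; first by rewrite ffunE dfwith_in.
  by move=> i ij; rewrite ffunE dfwith_out.
apply: laurent_sum => i _; apply: (lF i (fun v => l (single i v))).
by move=> a u v; rewrite singleE hl.
Qed.

(** * Polynomials with Laurent coefficients *)

Section Polynomials.
Variables (V : lmodType K) (n : nat).
Implicit Types (P Q : bundle V -> {mpoly K[n]}).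

Definition laurent_mpoly P : Prop := forall mu, laurent (fun x => (P x)@_mu).

Lemma eq_laurent_mpoly P Q :
  (forall x, base K x.1 -> P x = Q x) -> laurent_mpoly Q -> laurent_mpoly P.
Proof. by move=> PQ lQ mu; apply: eq_laurent (lQ mu) => x /PQ ->. Qed.

Lemma laurent_mpoly_cst p : laurent_mpoly (fun=> p).
Proof. by move=> mu; apply: laurent_cst. Qed.

Lemma laurent_mpolyD P Q :
  laurent_mpoly P -> laurent_mpoly Q -> laurent_mpoly (fun x => P x + Q x).
Proof.
move=> lP lQ mu; apply: eq_laurent (laurentD (lP mu) (lQ mu)) => x _.
exact: mcoeffD.
Qed.

Lemma laurent_mpolyN P : laurent_mpoly P -> laurent_mpoly (fun x => - P x).
Proof.
move=> lP mu; apply: eq_laurent (laurentN (lP mu)) => x _.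
exact: mcoeffN.
Qed.

Lemma laurent_mpolyB P Q :
  laurent_mpoly P -> laurent_mpoly Q -> laurent_mpoly (fun x => P x - Q x).
Proof. by move=> lP lQ; apply: laurent_mpolyD => //; apply: laurent_mpolyN. Qed.

Lemma laurent_mpolyZ f P :
  laurent f -> laurent_mpoly P -> laurent_mpoly (fun x => f x *: P x).
Proof.
move=> lf lP mu; apply: eq_laurent (laurentM lf (lP mu)) => x _.
exact: mcoeffZ.
Qed.

Lemma laurent_mpolyM P Q :
  laurent_mpoly P -> laurent_mpoly Q -> laurent_mpoly (fun x => P x * Q x).
Proof.
move=> lP lQ mu; apply: eq_laurent; first by move=> x _; rewrite mcoeffM.
by apply: laurent_sum => i _; apply: laurentM.
Qed.

Lemma laurent_mpolyX P k : laurent_mpoly P -> laurent_mpoly (fun x => P x ^+ k).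
Proof.
move=> lP; elim: k => [|k IH]; first exact: laurent_mpoly_cst 1.
apply: eq_laurent_mpoly (laurent_mpolyM lP IH) => x _.
by rewrite exprS.
Qed.

Lemma laurent_mpolyMn P k : laurent_mpoly P -> laurent_mpoly (fun x => P x *+ k).
Proof.
move=> lP; apply: eq_laurent_mpoly (laurent_mpolyZ (laurent_cst _ k%:R) lP).
by move=> x _; rewrite scaler_nat.
Qed.

Lemma laurent_mpoly_deriv i P :
  laurent_mpoly P -> laurent_mpoly (fun x => (P x)^`M(i)).
Proof.
move=> lP mu; apply: eq_laurent (laurent_mpolyMn (mu i).+1 lP (mu + U_(i))%MM).
by move=> x _; rewrite mcoeff_deriv raddfMn.
Qed.

(** Projecting to degree d makes a polynomial-valued map land in [Sym K n d] everywhere, and changes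
    nothing where its value is already homogeneous of degree d. Its coefficients are those of [P] in
    degree d and zero elsewhere. *)
Lemma laurent_mpoly_pihomog d P :
  laurent_mpoly P -> laurent_mpoly (fun x => pihomog mdeg d (P x)).
Proof.
move=> lP mu.
apply: (@eq_laurent _ _ (fun x => if mdeg mu == d then (P x)@_mu else 0)).
  move=> x _; case: ifPn => [/eqP dmu|dmu]; last first.
    by rewrite (dhomog_nemf_coeff (pihomogP _ _ _)).
  rewrite pihomogE raddf_sum /=.
  have -> : (P x)@_mu = (\sum_(m <- msupp (P x)) (P x)@_m *: 'X_[m])@_mu.
    by rewrite -mpolyE.
  rewrite raddf_sum /= big_mkcond; apply: eq_bigr => m _.
  case: eqP => // md; rewrite mcoeffZ mcoeffX.
  by case: eqP => [mE|_]; [case: md; rewrite mE | rewrite mulr0].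
by case: (_ == _); [apply: lP | apply: laurent_cst].
Qed.

Lemma laurent_map_sym d (F : bundle V -> Sym K n d) :
  laurent_mpoly (fun x => val (F x)) -> laurent_map F.
Proof.
move=> lF l hl.
(* The monomials of degree at most d form a finite type; [b m] is the monomial itself in degree d
   and zero below, so the [b m] span [Sym K n d]. *)
pose b (m : 'X_{1..n < d.+1}) : Sym K n d := DHomog (pihomogP mdeg d 'X_[m]).
apply: (@eq_laurent _ _ (fun x =>
  \sum_(m : 'X_{1..n < d.+1}) (val (F x))@_m * l (b m))).
  move=> x _ /=; have hF := valP (F x).
  have {1}-> : F x = \sum_(m : 'X_{1..n < d.+1}) (val (F x))@_m *: b m.
    apply: val_inj; rewrite raddf_sum /= -[LHS](pihomog_dE hF).
    rewrite [X in pihomog _ _ X](@mpolywE _ _ d.+1).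
      by rewrite raddf_sum /=; apply: eq_bigr => m _; rewrite linearZ.
    rewrite msizeE; apply/bigmax_leqP_seq => m hm _.
    by rewrite (dhomog_mf hF hm).
  by rewrite scalar_sum //; apply: eq_bigr => m _; rewrite scalarZ.
by apply: laurent_sum => m _; apply: laurentM => //; apply: laurent_cst.
Qed.

End Polynomials.

End LaurentFunctions.
(** * Barycentric coordinates *)

Section Descent.
Variables (K : numFieldType) (n : nat).
Implicit Types (w u : 'rV[K]_n).
Local Notation params := ((K^o * K^o) * ('rV[K]_n * 'rV[K]_n))%type.

Lemma symvecD w u : symvec (w + u) = symvec w + symvec u.
Proof. by rewrite -big_split; apply: eq_bigr => j _; rewrite mxE scalerDl. Qed.

Lemma symvecZ (a : K) w : symvec (a *: w) = a *: symvec w.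
Proof. by rewrite scaler_sumr; apply: eq_bigr => j _; rewrite mxE scalerA. Qed.

Lemma symvecN w : symvec (- w) = - symvec w.
Proof. by rewrite -scaleN1r symvecZ scaleN1r. Qed.

Lemma symvecB w u : symvec (w - u) = symvec w - symvec u.
Proof. by rewrite symvecD symvecN. Qed.

Lemma mcoeff_symvec w j : (symvec w)@_U_(j) = w 0 j.
Proof.
rewrite raddf_sum (bigD1 j) //= mcoeffZ mcoeffX eqxx mulr1 big1 ?addr0 // => i ij.
rewrite mcoeffZ mcoeffX; case: eqP => [/(congr1 (fun m : 'X_{1..n} => m i))|_].
  by rewrite !mnm1E eqxx eq_sym (negPf ij).
by rewrite mulr0.
Qed.

(* [w] is the barycenter of the weighted points [(m1, v1)], [(m2, v2)], and     *)
(* [u = v1 - v2].                                                               *)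
Definition of_center (x : params) : params :=
  (x.1, (x.2.1 + (x.1.2 / (x.1.1 + x.1.2)) *: x.2.2,
         x.2.1 - (x.1.1 / (x.1.1 + x.1.2)) *: x.2.2)).

Definition to_center (x : params) : params :=
  (x.1, ((x.1.1 / (x.1.1 + x.1.2)) *: x.2.1 + (x.1.2 / (x.1.1 + x.1.2)) *: x.2.2,
         x.2.1 - x.2.2)).

Lemma to_centerK x : base K x.1 -> of_center (to_center x) = x.
Proof.
case: x => [[m1 m2] [v1 v2]] [/= h1 h2 h3]; rewrite /of_center /=.
congr (_, (_, _)); apply/matrixP => i j; rewrite !mxE; by field.
Qed.

(** These functions of (w, u) are the ones that factor through the cuspidal map with Laurent
    coefficients. They form a ring, so it suffices to treat the generators w, u^2 and (m1 - m2)
    u^3. *)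
Definition descends (f : params -> {mpoly K[n]}) : Prop :=
  exists2 P : cuspidal_space K n -> {mpoly K[n]}, laurent_mpoly P &
    forall x, base K x.1 -> P (cuspidal_map x) = f x.

Lemma cuspidal_map1 x : (@cuspidal_map K n x).1 = x.1.
Proof. by case: x => [[m1 m2] [w u]]. Qed.

Lemma eq_descends f g :
  (forall x, base K x.1 -> f x = g x) -> descends g -> descends f.
Proof. by move=> fg [P lP PE]; exists P => // x bx; rewrite PE ?fg. Qed.

Lemma descendsD f g : descends f -> descends g -> descends (fun x => f x + g x).
Proof.
move=> [P lP PE] [Q lQ QE]; exists (fun y => P y + Q y).
  exact: laurent_mpolyD.
by move=> x bx; rewrite PE ?QE.
Qed.

Lemma descendsM f g : descends f -> descends g -> descends (fun x => f x * g x).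
Proof.
move=> [P lP PE] [Q lQ QE]; exists (fun y => P y * Q y).
  exact: laurent_mpolyM.
by move=> x bx; rewrite PE ?QE.
Qed.

Lemma descendsX f k : descends f -> descends (fun x => f x ^+ k).
Proof.
move=> [P lP PE]; exists (fun y => P y ^+ k); first exact: laurent_mpolyX.
by move=> x bx; rewrite PE.
Qed.

Lemma descendsMn f k : descends f -> descends (fun x => f x *+ k).
Proof.
move=> [P lP PE]; exists (fun y => P y *+ k); first exact: laurent_mpolyMn.
by move=> x bx; rewrite PE.
Qed.

Lemma descendsZ (c : K * K -> K) f :
  laurent (fun y : cuspidal_space K n => c y.1) -> descends f ->
  descends (fun x => c x.1 *: f x).
Proof.
move=> lc [P lP PE]; exists (fun y => c y.1 *: P y).
  exact: laurent_mpolyZ.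
by move=> x bx; rewrite PE ?cuspidal_map1.
Qed.

Lemma descends_cst p : descends (fun=> p).
Proof. by exists (fun=> p) => //; apply: laurent_mpoly_cst. Qed.

Lemma descends_sum (I : Type) (r : seq I) (S : pred I)
    (f : I -> params -> {mpoly K[n]}) :
  (forall i, S i -> descends (f i)) ->
  descends (fun x => \sum_(i <- r | S i) f i x).
Proof.
move=> df; elim: r => [|i r IH].
  by apply: eq_descends (descends_cst 0) => x _; rewrite big_nil.
apply: (@eq_descends _ (fun x => (if S i then f i x else 0) +
                                 \sum_(i <- r | S i) f i x)).
  by move=> x _; rewrite big_cons; case: ifP => _; rewrite ?add0r.
by apply: descendsD => //; case Si: (S i); [exact: df | exact: descends_cst].
Qed.

Lemma descends_center : descends (fun x => symvec x.2.1).
Proof.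
exists (fun y => symvec y.2.1.1); last by case=> [[m1 m2] [w u]].
move=> mu; apply: laurent_scalar => a x y /=.
by rewrite symvecD symvecZ mcoeffD mcoeffZ.
Qed.

Lemma descends_sqr : descends (fun x => symvec x.2.2 ^+ 2).
Proof.
exists (fun y => val y.2.1.2); last by case=> [[m1 m2] [w u]].
by move=> mu; apply: laurent_scalar => a x y /=; rewrite mcoeffD mcoeffZ.
Qed.

Lemma descends_cube :
  descends (fun x => (x.1.1 - x.1.2 : K) *: symvec x.2.2 ^+ 3).
Proof.
exists (fun y => val y.2.2); last by case=> [[m1 m2] [w u]].
by move=> mu; apply: laurent_scalar => a x y /=; rewrite mcoeffD mcoeffZ.
Qed.

Lemma laurent_centered_coef j :
  laurent (fun y : cuspidal_space K n => centered_coef y.1.1 y.1.2 j).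
Proof.
apply: (@eq_laurent _ _ _ (fun y => (y.1.1 * y.1.2 ^+ j +
    y.1.2 * (- y.1.1) ^+ j) * (y.1.1 + y.1.2)^-1 ^+ j)).
  by move=> y _; rewrite exprVn.
apply: laurentM; last exact/laurentX/laurent_m12V.
apply: laurentD; apply: laurentM; try exact: laurent_scalar;
  apply: laurentX; try apply: laurentN; exact: laurent_scalar.
Qed.

(** For odd j the numerator of c_j is -m1 m2 (m1^(j-1) - m2^(j-1)), and the difference of powers is
    divisible by m1 - m2. *)
Lemma centered_coef_odd (m1 m2 : K) i : centered_coef m1 m2 i.*2.+3 =
  - (m1 * m2 * (\sum_(r < i.*2.+2) m1 ^+ (i.*2.+1 - r) * m2 ^+ r)
     / (m1 + m2) ^+ i.*2.+3) * (m1 - m2).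
Proof.
have sub := subrXX m1 m2 i.*2.+2.
rewrite /centered_coef mulNr mulrAC -mulNr; congr (_ / _).
rewrite -[m1 * m2 * _ * _]mulrA [_ * (m1 - m2)]mulrC -sub.
rewrite exprS [in (- m1) ^+ _]exprS exprNn /= -signr_odd /= negbK odd_double.
by ring.
Qed.

(** An even power of u is a power of u^2. For j = 1 the coefficient vanishes. For j = 2i + 3 the
    factor m1 - m2 of c_j is absorbed into u^j = (u^2)^i u^3. *)
Lemma descends_power_term j k : descends (fun x =>
  centered_coef x.1.1 x.1.2 j *: (symvec x.2.1 ^+ k * symvec x.2.2 ^+ j)).
Proof.
have [/even_halfK jE|jodd] := boolP (~~ odd j).
  apply: (descendsZ (c := fun m => centered_coef m.1 m.2 j)).
    exact: laurent_centered_coef.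
  apply: descendsM; first exact/descendsX/descends_center.
  apply: eq_descends (descendsX j./2 descends_sqr) => x _.
  by rewrite -exprM mul2n jE.
case: j jodd => [|[|j]] //= jodd.
  apply: eq_descends (descends_cst 0) => x _.
  by rewrite centered_coef1 scale0r.
case: j jodd => [|j] //=; rewrite !negbK => jev.
have jE := even_halfK jev; set i := j./2 in jE; rewrite -jE.
pose c (m : K * K) := - (m.1 * m.2 *
  (\sum_(r < i.*2.+2) m.1 ^+ (i.*2.+1 - r) * m.2 ^+ r) /
  (m.1 + m.2) ^+ i.*2.+3).
apply: (@eq_descends _ (fun x => c x.1 *:
  (symvec x.2.1 ^+ k * ((symvec x.2.2 ^+ 2) ^+ i *
    ((x.1.1 - x.1.2 : K) *: symvec x.2.2 ^+ 3))))).
  move=> x _; rewrite centered_coef_odd -/(c x.1) -scalerA; congr (_ *: _).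
  by rewrite -!scalerAr -exprM -exprD mul2n addn3.
apply: descendsZ.
  rewrite /c; apply: laurentN.
  apply: (@eq_laurent _ _ _ (fun y => y.1.1 * y.1.2 *
    (\sum_(r < i.*2.+2) y.1.1 ^+ (i.*2.+1 - r) * y.1.2 ^+ r) *
    (y.1.1 + y.1.2)^-1 ^+ i.*2.+3)).
    by move=> y _; rewrite exprVn.
  apply: laurentM; last exact/laurentX/laurent_m12V.
  do !apply: laurentM; try exact: laurent_scalar.
  apply: laurent_sum => r _.
  by apply: laurentM; apply/laurentX/laurent_scalar.
apply: descendsM; first exact/descendsX/descends_center.
by apply: descendsM; [exact/descendsX/descends_sqr | exact/descends_cube].
Qed.

Lemma descends_power_sum k : descends (fun x =>
  let: (m, (v1, v2)) := of_center x in
  power_sum m.1 m.2 (symvec v1) (symvec v2) k).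
Proof.
apply: (@eq_descends _ (fun x => \sum_(j < k.+1)
  (centered_coef x.1.1 x.1.2 j *:
    (symvec x.2.1 ^+ (k - j) * symvec x.2.2 ^+ j)) *+ 'C(k, j))).
  by move=> x _; rewrite /= symvecD symvecB !symvecZ power_sum_centered.
by apply: descends_sum => j _; apply: descendsMn; apply: descends_power_term.
Qed.

(** Strong induction through Newton's identity, which is solved for the next e by dividing by k + 1
    in characteristic zero. *)
Lemma descends_epoly k : descends (fun x =>
  let: (m, (v1, v2)) := of_center x in epoly k m.1 m.2 (symvec v1) (symvec v2)).
Proof.
elim/ltn_ind: k => [[_|k IH]].
  apply: eq_descends (descends_cst 1) => x _ /=.
  by rewrite epoly0.
apply: (@eq_descends _ (fun x => k.+1%:R^-1 *: \sum_(i < k.+1)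
  (let: (m, (v1, v2)) := of_center x in epoly i m.1 m.2 (symvec v1) (symvec v2)) *
  ((-1) ^+ (k - i) *: let: (m, (v1, v2)) := of_center x in
      power_sum m.1 m.2 (symvec v1) (symvec v2) (k - i).+1))).
  move=> x _ /=; rewrite -newton_epoly -[X in _ = _ *: X]scaler_nat scalerA.
  by rewrite mulVf ?scale1r // pnatr_eq0.
apply: (descendsZ (c := fun=> k.+1%:R^-1)); first exact: laurent_cst.
apply: descends_sum => i _; apply: descendsM; first exact: IH.
apply: (descendsZ (c := fun=> (-1) ^+ (k - i))); first exact: laurent_cst.
exact: descends_power_sum.
Qed.

Lemma cuspidal_to_Delta N : exists Psi : cuspidal_space K n -> Delta_space K n N,
  [/\ forall y, (Psi y).1 = y.1, laurent_map Psi &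
      forall x, base K x.1 -> Psi (cuspidal_map x) = Delta_map N (of_center x)].
Proof.
have /boolp.choice[P PP] k : exists P : cuspidal_space K n -> {mpoly K[n]},
    laurent_mpoly P /\ forall x, base K x.1 -> P (cuspidal_map x) =
      let: (m, (v1, v2)) := of_center x in
      epoly k m.1 m.2 (symvec v1) (symvec v2).
  by have [P] := descends_epoly k; exists P.
(* The values of [P] need be homogeneous only on the cuspidal image, hence the projection to degree
   i+1. *)
exists (fun y => (y.1, [ffun i : 'I_N =>
  (DHomog (pihomogP mdeg i.+1 (P i.+1 y)) : Sym K n i.+1)])); split=> //.
  apply: laurent_map_pair.
    by move=> l hl; apply: laurent_scalar => a x y /=; rewrite hl.
  apply: laurent_map_dprod => i; apply: laurent_map_sym.
  apply: (@eq_laurent_mpoly _ _ _ _ (fun y => pihomog mdeg i.+1 (P i.+1 y))).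
    by move=> y _; rewrite ffunE.
  by apply: laurent_mpoly_pihomog; case: (PP i.+1).
move=> x bx; case: x bx => [[m1 m2] [w u]] bx; congr (_, _).
apply/ffunP => i; rewrite !ffunE; apply: val_inj => /=.
have [_ /(_ (m1, m2, (w, u)) bx) /= ->] := PP i.+1.
by rewrite pihomog_dE //; apply: epoly_homog.
Qed.

(** With m = m1 + m2, one has p_1 = m w, then p_2 = m w^2 + (m1 m2 / m) u^2, and p_3 adds a unit
    multiple of (m1 - m2) u^3 to terms already known. Solving never divides by m1 - m2, so the
    inverse is regular across the diagonal too. *)
Lemma Delta_to_cuspidal N : (3 <= N)%N ->
  exists Phi : Delta_space K n N -> cuspidal_space K n,
  [/\ forall y, (Phi y).1 = y.1, laurent_map Phi &
      forall x, base K x.1 -> Phi (Delta_map N (of_center x)) = cuspidal_map x].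
Proof.
move=> N3.
have [N1 N2] : (0 < N)%N /\ (1 < N)%N by split; apply: leq_trans N3.
(* Indices shift by one: [e k] reads the coordinate e_(k+1). *)
pose e k (kN : (k < N)%N) (x : Delta_space K n N) : {mpoly K[n]} :=
  val (x.2 (Ordinal kN)).
pose p1 := e 0 N1.
pose p2 x := p1 x * p1 x - e 1 N2 x *+ 2.
pose p3 x := e 2 N3 x *+ 3 - e 1 N2 x * p1 x + p1 x * p2 x.
pose w x := (x.1.1 + x.1.2)^-1 *: p1 x.
pose a x := ((x.1.1 + x.1.2) / (x.1.1 * x.1.2)) *:
  (p2 x - (x.1.1 + x.1.2) *: w x ^+ 2).
pose b x := - ((x.1.1 + x.1.2) ^+ 2 / (x.1.1 * x.1.2)) *:
  (p3 x - (x.1.1 + x.1.2) *: w x ^+ 3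
   - (x.1.1 * x.1.2 / (x.1.1 + x.1.2)) *: (w x * a x) *+ 3).
have le k kN : laurent_mpoly (e k kN).
  move=> mu; apply: laurent_scalar => c x y.
  by rewrite /e /= !ffunE /= mcoeffD mcoeffZ.
have [lp1 le1 le2] :
    [/\ laurent_mpoly p1, laurent_mpoly (e 1 N2) & laurent_mpoly (e 2 N3)].
  by split; apply: le.
have lp2 : laurent_mpoly p2.
  by apply: laurent_mpolyB; [exact: laurent_mpolyM | exact: laurent_mpolyMn].
have lp3 : laurent_mpoly p3.
  apply: laurent_mpolyD; last exact: laurent_mpolyM.
  by apply: laurent_mpolyB; [exact: laurent_mpolyMn | exact: laurent_mpolyM].
have lm : laurent (fun x : Delta_space K n N => x.1.1 + x.1.2).
  by apply: laurentD; apply: laurent_scalar.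
have lm12V : laurent (fun x : Delta_space K n N => (x.1.1 * x.1.2)^-1).
  apply: eq_laurent (laurentM (laurent_m1V _) (laurent_m2V _)) => x _.
  by rewrite invfM.
have lw : laurent_mpoly w by apply: laurent_mpolyZ => //; apply: laurent_m12V.
have la : laurent_mpoly a.
  apply: laurent_mpolyZ; first exact: laurentM.
  apply: laurent_mpolyB => //; apply: laurent_mpolyZ => //; exact: laurent_mpolyX.
have lb : laurent_mpoly b.
  apply: laurent_mpolyZ; first by apply/laurentN/laurentM => //; apply: laurentX.
  apply: laurent_mpolyB.
    apply: laurent_mpolyB => //; apply: laurent_mpolyZ => //.
    exact: laurent_mpolyX.
  apply: laurent_mpolyMn; apply: laurent_mpolyZ; last exact: laurent_mpolyM.
  apply: laurentM; last exact: laurent_m12V.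
  by apply: laurentM; apply: laurent_scalar.
exists (fun x => (x.1, (\row_j (w x)@_U_(j),
   (DHomog (pihomogP mdeg 2 (a x)) : Sym K n 2),
   (DHomog (pihomogP mdeg 3 (b x)) : Sym K n 3)))); split => //.
  apply: laurent_map_pair.
    by move=> l hl; apply: laurent_scalar => c x y /=; rewrite hl.
  do 2?apply: laurent_map_pair.
  - apply: laurent_map_row => j; apply: eq_laurent (lw U_(j)%MM) => x _.
    by rewrite mxE.
  - by apply: laurent_map_sym; apply: laurent_mpoly_pihomog.
  - by apply: laurent_map_sym; apply: laurent_mpoly_pihomog.
move=> x; set y := Delta_map _ _.
case: x @y => [[m1 m2] [w0 u0]] y bx; have [/= h1 h2 h3] := bx.
pose X1 := symvec w0 + (m2 / (m1 + m2)) *: symvec u0.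
pose X2 := symvec w0 - (m1 / (m1 + m2)) *: symvec u0.
have eE k kN : e k kN y = epoly k.+1 m1 m2 X1 X2.
  by rewrite /e ffunE /= symvecD symvecB !symvecZ.
have p1E : p1 y = power_sum m1 m2 X1 X2 1 by rewrite power_sum1E -(eE 0).
have p2E : p2 y = power_sum m1 m2 X1 X2 2.
  by rewrite power_sum2E -p1E -(eE 0 N1) -(eE 1 N2).
have p3E : p3 y = power_sum m1 m2 X1 X2 3.
  by rewrite power_sum3E -p1E -p2E -(eE 0 N1) -(eE 1 N2) -(eE 2 N3).
have hw : w y = symvec w0.
  by rewrite /w p1E power_sum1_centered // scalerA mulVf // scale1r.
have ha : a y = symvec u0 ^+ 2.
  rewrite /a hw p2E power_sum2_centered // addrAC subrr add0r scalerA.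
  by rewrite [X in X *: _](_ : _ = 1) ?scale1r //=; field; apply/and3P.
have hb : b y = (m1 - m2) *: symvec u0 ^+ 3.
  rewrite /b hw ha p3E power_sum3_centered //.
  have E (s t z : {mpoly K[n]}) : s + t - z - s - t = - z by ring.
  move: (_ *: symvec u0 ^+ 3) => c.
  rewrite E scalerN -scaleNr opprK scalerA.
  by rewrite [X in X *: _](_ : _ = 1) ?scale1r //=; field; apply/and3P.
congr (_, (_, _, _)).
- by apply/rowP => j; rewrite mxE hw mcoeff_symvec.
- by apply: val_inj; rewrite /= ha pihomog_dE // symvecX_homog.
- apply: val_inj; rewrite /= hb pihomog_dE //.
  exact/dhomogZ/symvecX_homog.
Qed.

End Descent.
(** * Closed subsets over the base *)

Section LocallyClosed.
Variable K : fieldType.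
Implicit Types V W : lmodType K.
Local Notation bundle V := ((K^o * K^o) * V)%type.

Lemma zariski_openT V : zariski_open (setT : set V).
Proof.
exists [set fun=> 1]; split; first by move=> f ->; apply: polyfun_cst.
apply/seteqP; split=> x /=; first by move=> /(_ I).
by move=> /(_ (fun=> 1) erefl) /eqP; rewrite oner_eq0.
Qed.

Lemma zariski_open_neq0 V (f : V -> K) :
  polyfun f -> zariski_open [set x | f x != 0].
Proof.
move=> pf; exists [set f]; split; first by move=> _ ->.
apply/seteqP; split=> x /=; first by move=> /negP; rewrite negbK => /eqP fx _ ->.
by move=> /(_ f erefl) ->; rewrite eqxx.
Qed.

Lemma laurent_regular V (X : set (bundle V)) f :
  (forall x, X x -> base K x.1) -> laurent f -> regular_function X f.
Proof.
move=> Xb [g [k [pg fE]]] x Xx.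
exists setT, g, (fun y => disc y.1 ^+ k); split=> //.
- exact: zariski_openT.
- exact/polyfun_exp/polyfun_disc.
- by move=> y /Xb by_ _; rewrite fE // expf_neq0 //; apply/baseE.
Qed.

(** This says that X is the common zero locus, over the base, of the Laurent functions vanishing on
    it. It is closedness over the base in a form that pulls back along Laurent maps. *)
Definition laurent_closed V (X : set (bundle V)) : Prop :=
  (forall x, X x -> base K x.1) /\
  forall x, base K x.1 ->
    (forall f, laurent f -> (forall y, X y -> f y = 0) -> f x = 0) -> X x.

Lemma laurent_closed_locally_closed V (X : set (bundle V)) :
  laurent_closed X -> locally_closed X.
Proof.
move=> [Xb Xc].
pose S : set (bundle V -> K) := [set f | polyfun f /\ forall y, X y -> f y = 0].
exists [set x | disc x.1 != 0], [set x | forall f, S f -> f x = 0]; split.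
- exact/zariski_open_neq0/polyfun_disc.
- by exists S; split=> // f [].
apply/seteqP; split=> x /=.
  by move=> Xx; split; [apply/baseE/Xb | move=> f [_]; exact].
(* Denominators are cleared: the numerator [g] vanishes on X because [disc] is nonzero there. *)
move=> [/baseE bx Sx]; apply: Xc => // f [g [k [pg fE]]] f0.
rewrite fE // (Sx g) ?mul0r //; split=> // y Xy.
have /baseE dy := Xb y Xy; have /eqP := f0 y Xy.
rewrite fE; last exact: Xb.
by rewrite mulf_eq0 invr_eq0 expf_eq0 (negPf dy) andbF orbF => /eqP.
Qed.

Lemma laurent_closed_fiber V (X : set (bundle V)) s :
  laurent_closed X -> laurent_closed (fiber fst X s).
Proof.
move=> [Xb Xc]; split=> [x [/Xb]//|x bx fx]; split.
  by apply: Xc => // f lf f0; apply: fx => // y [/f0].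
have h1 := fx (fun y => y.1.1 - s.1)
  (laurentB (laurent_m1 V) (laurent_cst V s.1)).
have h2 := fx (fun y => y.1.2 - s.2)
  (laurentB (laurent_m2 V) (laurent_cst V s.2)).
case: x s h1 h2 {bx fx} => [[a b] c] [s1 s2] /= h1 h2; congr (_, _); apply/eqP;
  rewrite -subr_eq0; apply/eqP; [apply: h1 | apply: h2] => y [_ ->]; exact: subrr.
Qed.

(** Over the base, X is cut out by the conditions F x in Y and G (F x) = x. The second one is tested
    on linear forms, which is why they are assumed to separate points. *)
Lemma laurent_closed_retract V W (X : set (bundle V)) (Y : set (bundle W))
    (F : bundle V -> bundle W) (G : bundle W -> bundle V) :
  (forall x y, (forall l : bundle V -> K, scalar l -> l x = l y) -> x = y) ->
  (forall x, (F x).1 = x.1) -> (forall y, (G y).1 = y.1) ->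
  laurent_map F -> laurent_map G ->
  (forall x, X x -> Y (F x)) -> (forall y, Y y -> X (G y)) ->
  (forall x, X x -> G (F x) = x) ->
  laurent_closed Y -> laurent_closed X.
Proof.
move=> sepV F1 G1 lF lG XY YX GF [Yb Yc].
have comp f : laurent f -> laurent (f \o F).
  apply: laurent_comp => // [x|]; first by rewrite F1.
  by apply: eq_laurent (laurent_discV V) => x _; rewrite F1.
split=> [x /XY/Yb|x bx hx]; first by rewrite F1.
have YFx : Y (F x).
  apply: Yc => [|f lf f0]; first by rewrite F1.
  by apply: (hx (f \o F)) => [|y /XY /f0 //]; apply: comp.
suff <- : G (F x) = x by apply: YX.
apply: sepV => l hl; apply/eqP; rewrite -subr_eq0; apply/eqP.
apply: (hx (fun x => l (G (F x)) - l x)) => [|y /GF ->]; last exact: subrr.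
by apply: laurentB; [apply: (comp (l \o G)); exact: lG | exact: laurent_scalar].
Qed.

Lemma laurent_regular_map V W (X : set (bundle V)) (Y : set (bundle W)) F :
  (forall x, X x -> base K x.1) -> (forall x, X x -> Y (F x)) ->
  laurent_map F -> regular_map X Y F.
Proof.
by move=> Xb XY lF; split=> // l hl; apply: laurent_regular => //; apply: lF.
Qed.

End LocallyClosed.

(** * Equations of the cuspidal image *)

Section Cuspidal.
Variables (K : numClosedFieldType) (n : nat).

Lemma dhomog_deriv d j (p : {mpoly K[n]}) :
  p \is d.+1.-homog -> p^`M(j) \is d.-homog.
Proof.
move=> hp; apply/dhomogP => m; rewrite mcoeff_msupp mcoeff_deriv => nz.
apply/eqP; rewrite -eqSS -addn1 -(mdeg1 j) -mdegD; apply: contraNT nz => dm.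
by rewrite (dhomog_nemf_coeff hp) // mul0rn.
Qed.

Lemma dhomog0E (p : {mpoly K[n]}) : p \is 0.-homog -> p = (p@_0)%:MP.
Proof.
move=> hp; apply/mpolyP => m; rewrite mcoeffC.
have [->|m0] := eqVneq m 0%MM; first by rewrite mulr1.
by rewrite mulr0 (dhomog_nemf_coeff hp) // mdeg_eq0.
Qed.

Lemma dhomog1E (p : {mpoly K[n]}) :
  p \is 1.-homog -> exists u : 'rV[K]_n, p = symvec u.
Proof.
move=> hp; exists (\row_j p@_U_(j)); apply/mpolyP => m.
have [/eqP/mdeg1P[j /eqP ->]|dm] := eqVneq (mdeg m) 1%N.
  by rewrite mcoeff_symvec mxE.
by rewrite (dhomog_nemf_coeff hp) // (dhomog_nemf_coeff (symvecX_homog _ 1)).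
Qed.

Lemma mderiv_symvec j (u : 'rV[K]_n) : (symvec u)^`M(j) = (u 0 j)%:MP.
Proof.
have hu : (symvec u)^`M(j) \is 0.-homog.
  exact/dhomog_deriv/(symvecX_homog u 1).
by rewrite (dhomog0E hu) mcoeff_deriv mnm0E add0m mcoeff_symvec.
Qed.

(** Both sides equal 4 u_j^2 times the square of the linear form. As equations in the coefficients
    of a, these identities characterize the squares among quadratic forms. *)
Lemma mderiv_symvec_sqr j (u : 'rV[K]_n) (a := symvec u ^+ 2) :
  a^`M(j) ^+ 2 = (a^`M(j))^`M(j) * a *+ 2.
Proof.
rewrite /a expr2 mderivM mderiv_symvec mderivD !mderivM mderivC mderiv_symvec.
by ring.
Qed.

(* The second derivatives of [a] are constant: if one of them, [c], is nonzero *)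
(* then [2 c a] is the square of a linear form, and otherwise [a] vanishes.     *)
Lemma dhomog2_square (a : {mpoly K[n]}) : a \is 2.-homog ->
  (forall j, a^`M(j) ^+ 2 = (a^`M(j))^`M(j) * a *+ 2) ->
  exists u : 'rV[K]_n, a = symvec u ^+ 2.
Proof.
move=> ha da.
have [/existsP[j nz]|/existsPn a0] := boolP [exists j, (a^`M(j))^`M(j) != 0].
  have /dhomog0E cE := dhomog_deriv j (dhomog_deriv j ha).
  have [v vE] := dhomog1E (dhomog_deriv j ha).
  move: (da j) nz; rewrite {}cE {}vE; move: (_@_0) => c cE.
  rewrite mpolyC_eq0 => c0.
  have c20 : c *+ 2 != 0 by rewrite mulrn_eq0.
  exists ((sqrtC (c *+ 2))^-1 *: v); rewrite symvecZ exprZn cE exprVn sqrtCK.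
  by rewrite mul_mpolyC scalerMnl scalerA mulVf // scale1r.
exists 0; rewrite -[0](scale0r (0 : 'rV[K]_n)) symvecZ scale0r expr0n /=.
apply/mpolyP => m; rewrite mcoeff0.
have [m0|/eqP mN0] := eqVneq m 0%MM.
  by rewrite (dhomog_nemf_coeff ha) // m0 mf0.
have [j mj] : exists j, (0 < m j)%N.
  apply/existsP; apply: contra_notT mN0 => /existsPn m0; apply/mnmP => j.
  by rewrite mnm0E; apply/eqP; rewrite -leqn0 leqNgt.
have /eqP : a^`M(j) ^+ 2 = 0.
  by have := a0 j; rewrite negbK da => /eqP ->; rewrite mul0r mul0rn.
rewrite sqrf_eq0 => /eqP/mpolyP/(_ (m - U_(j))%MM).
rewrite mcoeff0 mcoeff_deriv submK; last by rewrite lep1mP -lt0n.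
by move/eqP; rewrite mulrn_eq0 => /eqP.
Qed.

(** The equations are those of [mderiv_symvec_sqr] on a, together with b^2 = (m1 - m2)^2 a^3. The
    first ones produce u with a = u^2; the last one fixes b up to a sign. *)
Lemma cuspidal_laurent_closed : laurent_closed (cuspidal K n).
Proof.
split=> [_ [[[m1 m2] [w u]] bx <-]//|].
move=> [[m1 m2] [[w a] b]] bx hx.
(* A polynomial identity valid on the image passes, coefficient by coefficient, to the given
   point. *)
have van (P : cuspidal_space K n -> {mpoly K[n]}) : laurent_mpoly P ->
    (forall y, base K y.1 -> P (cuspidal_map y) = 0) ->
    P ((m1, m2), (w, a, b)) = 0.
  move=> lP P0; apply/mpolyP => mu; rewrite mcoeff0.
  by apply: (hx (fun y => (P y)@_mu)) => [|_ [y hy <-]]; rewrite ?P0 ?mcoeff0.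
have la : laurent_mpoly (fun y : cuspidal_space K n => val y.2.1.2).
  by move=> mu; apply: laurent_scalar => c x y /=; rewrite mcoeffD mcoeffZ.
have lb : laurent_mpoly (fun y : cuspidal_space K n => val y.2.2).
  by move=> mu; apply: laurent_scalar => c x y /=; rewrite mcoeffD mcoeffZ.
have [j|u au] := dhomog2_square (valP a).
  apply/eqP; rewrite -subr_eq0; apply/eqP.
  apply: (van (fun y => (val y.2.1.2)^`M(j) ^+ 2 -
                 ((val y.2.1.2)^`M(j))^`M(j) * val y.2.1.2 *+ 2)).
    apply: laurent_mpolyB; first exact/laurent_mpolyX/laurent_mpoly_deriv.
    apply/laurent_mpolyMn/laurent_mpolyM => //.
    exact/laurent_mpoly_deriv/laurent_mpoly_deriv.
  move=> [[m1' m2'] [w' u']] _ /=.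
  by rewrite mderiv_symvec_sqr subrr.
have /eqP : val b ^+ 2 = ((m1 - m2) *: symvec u ^+ 3) ^+ 2.
  apply/eqP; rewrite exprZn -exprM mulnC exprM -au -subr_eq0; apply/eqP.
  apply: (van (fun y =>
    val y.2.2 ^+ 2 - (y.1.1 - y.1.2) ^+ 2 *: val y.2.1.2 ^+ 3)).
    apply: laurent_mpolyB; first exact: laurent_mpolyX.
    apply: laurent_mpolyZ; last exact: laurent_mpolyX.
    by apply/laurentX/laurentB; exact: laurent_scalar.
  move=> [[m1' m2'] [w' u']] _ /=.
  by rewrite exprZn -!exprM subrr.
rewrite eqf_sqr => /orP[] /eqP bu.
  exists ((m1, m2), (w, u)) => //; congr (_, (_, _, _)); exact: val_inj.
(* Replacing u by -u keeps a = u^2 and changes the sign of (m1 - m2) u^3. *)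
exists ((m1, m2), (w, - u)) => //; congr (_, (_, _, _)); apply: val_inj => /=.
  by rewrite symvecN sqrrN.
by rewrite bu symvecN exprNn -signr_odd /= expr1 mulN1r scalerN.
Qed.

End Cuspidal.

(** * The isomorphism and isotriviality *)

Section Main.
Variables (K : numClosedFieldType) (n N : nat).
Hypothesis N3 : (3 <= N)%N.

Lemma Delta_space_sep (x y : Delta_space K n N) :
  (forall l : Delta_space K n N -> K, scalar l -> l x = l y) -> x = y.
Proof.
case: x y => [[a1 a2] f] [[b1 b2] g] h.
have -> : a1 = b1 by apply: (h (fun x => x.1.1)).
have -> : a2 = b2 by apply: (h (fun x => x.1.2)).
congr (_, _); apply/ffunP => i; apply: val_inj; apply/mpolyP => mu.
apply: (h (fun x => (val (x.2 i))@_mu)) => c x y /=.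
by rewrite !ffunE /= mcoeffD mcoeffZ.
Qed.

Lemma Delta2_cuspidal :
  exists (Phi : Delta_space K n N -> cuspidal_space K n)
         (Psi : cuspidal_space K n -> Delta_space K n N),
  [/\ forall y, (Phi y).1 = y.1, forall y, (Psi y).1 = y.1,
      laurent_map Phi, laurent_map Psi &
      forall x, base K x.1 ->
        Psi (cuspidal_map x) = Delta_map N (of_center x) /\
        Phi (Delta_map N (of_center x)) = cuspidal_map x].
Proof.
have [Phi [Phi1 lPhi PhiE]] := Delta_to_cuspidal K n N3.
have [Psi [Psi1 lPsi PsiE]] := cuspidal_to_Delta K n N.
by exists Phi, Psi; split=> // x bx; rewrite PsiE // PhiE.
Qed.

Lemma Delta2_center y : Delta2 K n N y ->
  exists2 x, base K x.1 & y = Delta_map N (of_center x).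
Proof.
move=> [x bx <-]; exists (to_center x); last by rewrite to_centerK.
by case: x bx.
Qed.

Lemma of_center_Delta2 x : base K x.1 -> Delta2 K n N (Delta_map N (of_center x)).
Proof. by move=> bx; exists (of_center x). Qed.

Lemma Delta2_base x : Delta2 K n N x -> base K x.1.
Proof. by move=> [[[m1 m2] [v1 v2]] bx <-]. Qed.

Lemma Delta2_laurent_closed : laurent_closed (Delta2 K n N).
Proof.
have [Phi [Psi [Phi1 Psi1 lPhi lPsi E]]] := Delta2_cuspidal.
apply: (laurent_closed_retract (F := Phi) (G := Psi) _ _ _ _ _ _ _ _
         (@cuspidal_laurent_closed K n)) => //.
- exact: Delta_space_sep.
- by move=> _ /Delta2_center[x bx ->]; have [_ ->] := E x bx; exists x.
- by move=> _ [x bx <-]; have [-> _] := E x bx; apply: of_center_Delta2.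
- by move=> _ /Delta2_center[x bx ->]; have [e1 ->] := E x bx.
Qed.

Lemma Delta2_isomorphic : isomorphic_over fst fst (Delta2 K n N) (cuspidal K n).
Proof.
have [Phi [Psi [Phi1 Psi1 lPhi lPsi E]]] := Delta2_cuspidal.
split; first exact/laurent_closed_locally_closed/Delta2_laurent_closed.
  exact/laurent_closed_locally_closed/cuspidal_laurent_closed.
exists Phi, Psi; split; last by move=> x _; apply: Phi1.
split.
- apply: laurent_regular_map => //; first exact: Delta2_base.
  by move=> _ /Delta2_center[x bx ->]; have [_ ->] := E x bx; exists x.
- apply: laurent_regular_map => //.
    by case: (@cuspidal_laurent_closed K n).
  by move=> _ [x bx <-]; have [-> _] := E x bx; apply: of_center_Delta2.
- by move=> _ /Delta2_center[x bx ->]; have [e1 ->] := E x bx.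
- by move=> _ [x bx <-]; have [-> ->] := E x bx.
Qed.

(** For s off the diagonal this carries the fiber of the cuspidal image over s to the one over t,
    with the same parameters (w, u). *)
Definition rescale (s t : K^o * K^o) (y : cuspidal_space K n) :
    cuspidal_space K n :=
  (t, (y.2.1, ((t.1 - t.2) / (s.1 - s.2) : K) *: y.2.2)).

Lemma laurent_rescale s t : laurent_map (rescale s t).
Proof.
do 2?apply: laurent_map_pair.
- by move=> l hl; apply: laurent_cst.
- by move=> l hl; apply: laurent_scalar => c x y /=; rewrite hl.
- move=> l hl; apply: laurent_scalar => c x y /=.
  by rewrite scalerDr scalerA mulrC -scalerA hl.
Qed.

Lemma rescaleE s t m w u : m = s -> s.1 != s.2 ->
  rescale s t (cuspidal_map (m, (w, u))) = cuspidal_map (t, (w, u)).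
Proof.
move=> ->; case: s t => [s1 s2] [t1 t2] /= s12; congr (_, (_, _)).
by rewrite scalerA divfK // subr_eq0.
Qed.

(** The open set is the complement of the diagonal m1 = m2, on which the factor m1 - m2 can be
    rescaled to any other nonzero value. *)
Lemma Delta2_isotrivial : isotrivial (base K) fst (Delta2 K n N).
Proof.
have [Phi [Psi [Phi1 Psi1 lPhi lPsi E]]] := Delta2_cuspidal.
exists [set m | m.1 - m.2 != 0 :> K]; split.
- apply: (@zariski_open_neq0 K (K^o * K^o)%type (fun m => m.1 - m.2)).
  apply: polyfun_lin => c x y /=; by rewrite mulrBr opprD addrACA.
- exists (1, 2) => /=; split; last by rewrite /= subr_eq0 (eqr_nat K 1 2).
  split=> /=; first exact: oner_neq0.
    by rewrite (pnatr_eq0 K 2).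
  by rewrite -(natrD K 1 2) (pnatr_eq0 K 3).
move=> s t [bs s12] [bt t12].
have fiberE r z : fiber fst (Delta2 K n N) r z ->
    exists w u, base K r /\ z = Delta_map N (of_center (r, (w, u))).
  by move=> [/Delta2_center[[[m1 m2] [w u]] bx ->] /= <-]; exists w, u.
have lcl r : locally_closed (fiber fst (Delta2 K n N) r).
  apply: laurent_closed_locally_closed.
  by apply: laurent_closed_fiber; apply: Delta2_laurent_closed.
(* The rescaling is conjugated by the isomorphism with the cuspidal image; exchanging p and q gives
   the inverse on fibers. *)
pose Theta p q := Psi \o rescale p q \o Phi.
have ThetaE p q w u : base K p -> base K q -> p.1 - p.2 != 0 :> K ->
    Theta p q (Delta_map N (of_center (p, (w, u)))) =
    Delta_map N (of_center (q, (w, u))).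
  move=> bp bq p12; rewrite /Theta /=.
  have [_ ->] := E (p, (w, u)) bp.
  have p12' : p.1 != p.2 by rewrite -subr_eq0.
  by rewrite (rescaleE q w u (erefl p) p12'); have [] := E (q, (w, u)) bq.
have lTheta p q : base K q -> laurent_map (Theta p q).
  move=> bq l hl.
  have h1 : laurent (l \o Psi \o rescale p q).
    apply: (laurent_comp (F := rescale p q) (f := l \o Psi)) => //; last exact: lPsi.
      exact: (laurent_cst _ (disc q)^-1).
    exact: laurent_rescale.
  apply: (laurent_comp (F := Phi) _ _ _ h1) => // [x|]; first by rewrite Phi1.
  by apply: eq_laurent (laurent_discV _) => x _; rewrite Phi1.
have reg p q : base K p -> base K q -> p.1 - p.2 != 0 :> K ->
    regular_map (fiber fst (Delta2 K n N) p) (fiber fst (Delta2 K n N) q)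
      (Theta p q).
  move=> bp bq p12; apply: laurent_regular_map; last exact: lTheta.
    by move=> x [/Delta2_base].
  move=> _ /fiberE[w [u [_ ->]]]; rewrite ThetaE //; split.
    exact: of_center_Delta2.
  by case: q bq.
split=> //; exists (Theta s t), (Theta t s); split; try exact: reg.
- by move=> _ /fiberE[w [u [_ ->]]]; rewrite !ThetaE.
- by move=> _ /fiberE[w [u [_ ->]]]; rewrite !ThetaE.
Qed.

End Main.

Local Open Scope complex_scope.

Theorem proposition5p9 (R : realType) (n : nat) (hn : (1 <= n)%N) :
  exists N0 : nat, forall N : nat, (N0 <= N)%N ->
    isomorphic_over fst fst (Delta2 R[i] n N) (cuspidal R[i] n) /\
    isotrivial (base R[i]) fst (Delta2 R[i] n N).
Proof.
by exists 3 => N N3; split; [exact: Delta2_isomorphic | exact: Delta2_isotrivial].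
Qed.
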